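(* Let $T$ be a measure-preserving ergodic transformation of a standard probability space $(X,\mu)$, let $A$ be a Borel subset of $X$ and let $n\geq2$ be an integer. Then $A$ is equal (up to measure zero) to the support of an $n$-cycle belonging to $[T]_1$ if and only if there is a Borel set $B\subseteq A$ such that $$A=B\sqcup T_A(B)\sqcup\cdots\sqcup T_A^{n-1}(B)$$ (a disjoint union, up to measure zero).
   Context: A standard probability space $(X,\mu)$ is a standard Borel space with a non-atomic Borel probability measure. $\mathrm{Aut}(X,\mu)$ is the group of measure-preserving Borel bijections of $X$ modulo a.e. equality; everything is up to null sets. $T$ is ergodic if every Borel set which is a union of $T$-orbits has measure $0$ or $1$ (then a.e. orbit is infinite). Set $[T]=\{U\in\mathrm{Aut}(X,\mu): U(x)\in\{T^k(x):k\in\mathbb Z\}\text{ for a.e. }x\}$; each $U\in[T]$ has a cocycle $c_U:X\to\mathbb Z$ defined by $U(x)=T^{c_U(x)}(x)$, and the $\mathrm L^1$ full group is $[T]_1=\{U\in[T]:\int_X|c_U|\,d\mu<+\infty\}$. The support of $U$ is $\mathrm{supp}\,U=\{x:U(x)\neq x\}$. An element $U\in\mathrm{Aut}(X,\mu)$ is an $n$-cycle if every $U$-orbit has cardinality either $1$ or $n$. The induced transformation $T_A$ is defined by $T_A(x)=T^{n_A(x)}(x)$ for $x\in A$, where $n_A(x)$ is the least $k\geq1$ with $T^k(x)\in A$, and $T_A(x)=x$ for $x\notin A$ (and $T_A=\mathrm{id}_X$ if $A$ is null). *)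

(* Defs.v *)
From HB Require Import structures.
From mathcomp Require Import all_boot all_order all_algebra.
From mathcomp Require Import all_classical all_reals all_analysis.

Set Implicit Arguments.
Unset Strict Implicit.
Unset Printing Implicit Defensive.

Import Order.TTheory GRing.Theory Num.Theory.
Import numFieldNormedType.Exports.

Local Open Scope classical_set_scope.
Local Open Scope card_scope.
Local Open Scope ring_scope.

(* [Y] is a Polish space (a complete metric space, obtained as a Hausdorff
   pseudometric one, with a countable dense subset) and [f] transports its
   Borel sigma-algebra to the sigma-algebra of [X]. *)
Definition standard_borel (R : realType) (d : measure_display)
    (X : measurableType d) : Prop :=
  exists (Y : completePseudoMetricType R) (f : X -> Y),
    [/\ hausdorff_space Y,
        exists2 D : set Y, countable D & dense D,
        bijective f &
        forall E : set X, measurable E <-> <<s open >> (f @` E)].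

Definition nonatomic (R : realType) (d : measure_display)
    (X : measurableType d) (mu : probability X R) : Prop :=
  forall E : set X, measurable E -> (0 < mu E)%E ->
    exists F : set X, [/\ measurable F, F `<=` E, (0 < mu F)%E
                        & (mu F < mu E)%E].

(* A representative of an element of Aut(X, mu); equality almost everywhere is
   not quotiented out, so all the predicates below are stated up to null
   sets. *)
Record automorphism (R : realType) (d : measure_display)
    (X : measurableType d) (mu : probability X R) := Automorphism {
  aut_fun :> X -> X;
  aut_inv : X -> X;
  aut_funK : cancel aut_fun aut_inv;
  aut_invK : cancel aut_inv aut_fun;
  measurable_aut_fun : measurable_fun [set: X] aut_fun;
  measurable_aut_inv : measurable_fun [set: X] aut_inv;
  aut_preserving : forall E : set X, measurable E ->
    mu (aut_fun @^-1` E) = mu E }.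

Section FullGroup.
Context (R : realType) (d : measure_display) (X : measurableType d).
Context (mu : probability X R).
Implicit Types (T U : automorphism mu) (A B E F : set X).

Definition eq_mod_null E F : Prop := {ae mu, forall x, E x <-> F x}.

Definition aut_pow T (k : int) (x : X) : X :=
  match k with
  | Posz m => iter m T x
  | Negz m => iter m.+1 (aut_inv T) x
  end.

Definition aut_orbit T (x : X) : set X := range (fun k : int => aut_pow T k x).

Definition ergodic T : Prop :=
  forall E, measurable E -> (forall x, E x -> aut_orbit T x `<=` E) ->
    mu E = 0%E \/ mu E = 1%E.

Definition full_group T : set (automorphism mu) :=
  [set U | {ae mu, forall x, aut_orbit T x (U x)}].

(* When almost every T-orbit is infinite, such a [c] is unique up to a null
   set. *)
Definition is_cocycle T U (c : X -> int) : Prop :=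
  {ae mu, forall x, U x = aut_pow T (c x) x}.

Definition L1_full_group T : set (automorphism mu) :=
  [set U | full_group T U /\
    exists2 c : X -> int, is_cocycle T U c &
      mu.-integrable [set: X] (fun x => ((c x)%:~R : R)%:E)].

Definition aut_support U : set X := [set x | U x <> x].

Definition is_cycle (n : nat) U : Prop :=
  {ae mu, forall x, aut_orbit U x #= `I_1 \/ aut_orbit U x #= `I_n}.

Definition returns T A (x : X) : pred nat :=
  fun k => (1 <= k)%N && `[< A (iter k T x) >].

(* The value 0, taken when [x] never returns to [A], makes [induced_aut] the
   identity there; by Poincare recurrence, almost no [x] in [A] is
   concerned. *)
Definition return_time T A (x : X) : nat :=
  match pselect (exists k, returns T A x k) with
  | left ex_return => ex_minn ex_return
  | right _ => 0
  end.

Definition induced_aut T A (x : X) : X :=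
  if `[< mu A <> 0%E /\ A x >] then iter (return_time T A x) T x else x.

(* A is the disjoint union, up to null sets, of the F i for i < n. *)
Definition disjoint_union_mod_null A (n : nat) (F : nat -> set X) : Prop :=
  eq_mod_null A (\bigcup_(i < n) F i) /\
  forall i j, (i < n)%N -> (j < n)%N -> i <> j -> mu.-negligible (F i `&` F j).

End FullGroup.

(* Main.v *)
Require Import Defs.
From HB Require Import structures.
From mathcomp Require Import all_boot all_order all_algebra.
From mathcomp Require Import all_classical all_reals all_analysis.
From mathcomp Require Import measurable_realfun zify ring lra.
Set Implicit Arguments.
Unset Strict Implicit.
Unset Printing Implicit Defensive.
Import Order.TTheory GRing.Theory Num.Theory.
Local Open Scope classical_set_scope.
Local Open Scope card_scope.
Local Open Scope ring_scope.

(** Both directions take place inside one [T]-orbit at a time. Almost every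
    orbit is infinite ([ergodic_aperiodic]), hence ordered like the integers,
    and [ae_invariant_core] turns properties that hold almost everywhere into
    properties of all the points of almost every orbit.

    Let [B] be the base of a tower of height [n] that fills [A], and let [T_A],
    [T_B] be the induced transformations. On each orbit the visits to [A] are
    grouped into blocks of [n] consecutive ones, each starting in [B]. The
    product [T_B^-1 T_A] moves each visit to the next one, except that it sends
    the last visit of a block back to the first one, so it is an [n]-cycle with
    support [A]. By Kac's formula [T_A] and [T_B] have integrable cocycles
    ([induced_automorphism]), and the L1 full group is closed under products
    and inverses. This is [L1_cycle_of_tower].

    Conversely, let [U] be an [n]-cycle in the L1 full group with support [A].
    It suffices to find a measurable residue [r] modulo [n] such that [r (T x)]
    is [r x + 1] if [x] is in [A] and [r x] otherwise: then [T_A] adds one to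
    [r] and the part of [A] where [r] is 0 is the base of a tower
    ([tower_of_L1_cycle]). Morally, [r x] is the number of points of [A] that
    precede [x] on its orbit. That number is infinite, but modulo [n] the cycles
    of [U] that lie entirely before [x] contribute nothing, and only the cycles
    that straddle [x] need to be counted. Integrability of the cocycles of
    [U, U^2, .., U^(n-1)] and the Borel-Cantelli lemma show that only finitely
    many cycles straddle [x] ([ae_cocycle_le_time]). When [x] is replaced with
    [T x], the count grows by one if [x] is in [A], and it drops by [n] if the
    cycle of [x] ends at [x] ([overhang_step], [landing_eventually]). *)

(** * Automorphisms, orbits and periods *)

Section Automorphisms.
Context (R : realType) (d : measure_display) (X : measurableType d).
Context (mu : probability X R).
Implicit Types (T U V : automorphism mu) (A B E : set X) (x y : X).

Lemma measurable_aut_preimage T E : measurable E -> measurable (T @^-1` E).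
Proof.
by move=> mE; rewrite -[_ @^-1` _]setTI; exact: measurable_aut_fun.
Qed.

Lemma aut_sym_subproof T E : measurable E -> mu (aut_inv T @^-1` E) = mu E.
Proof.
move=> mE; rewrite -(aut_preserving T).
  by congr (mu _); apply/seteqP; split => x /=; rewrite aut_funK.
by rewrite -[_ @^-1` _]setTI; exact: measurable_aut_inv.
Qed.

Definition aut_sym T : automorphism mu :=
  Automorphism (aut_invK T) (aut_funK T) (measurable_aut_inv T)
    (measurable_aut_fun T) (@aut_sym_subproof T).

Lemma aut_comp_subproof T U E : measurable E ->
  mu ((T \o U) @^-1` E) = mu E.
Proof.
move=> mE; rewrite comp_preimage aut_preserving ?aut_preserving //.
exact: measurable_aut_preimage.
Qed.

Definition aut_comp T U : automorphism mu :=
  Automorphism (can_comp (aut_funK T) (aut_funK U))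
    (can_comp (aut_invK U) (aut_invK T))
    (measurableT_comp (measurable_aut_fun T) (measurable_aut_fun U))
    (measurableT_comp (measurable_aut_inv U) (measurable_aut_inv T))
    (@aut_comp_subproof T U).

Definition aut_id : automorphism mu :=
  @Automorphism _ _ _ mu idfun idfun (fun=> erefl) (fun=> erefl)
    (@measurable_id _ _ _) (@measurable_id _ _ _) (fun _ _ => erefl).

Definition aut_iter T (n : nat) : automorphism mu := iter n (aut_comp T) aut_id.

Lemma aut_iterE T n x : aut_iter T n x = iter n T x.
Proof. by elim: n => //= n ->. Qed.

Lemma measurable_iter_preimage T n E :
  measurable E -> measurable (iter n T @^-1` E).
Proof.
move=> mE; rewrite (_ : iter n T = aut_iter T n).
  exact: measurable_aut_preimage.
by apply/funext => x; rewrite aut_iterE.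
Qed.

Lemma mu_iter_preimage T n E : measurable E -> mu (iter n T @^-1` E) = mu E.
Proof.
move=> mE; rewrite (_ : iter n T = aut_iter T n) ?aut_preserving //.
by apply/funext => x; rewrite aut_iterE.
Qed.

Lemma aut_iterK T n : cancel (iter n T) (iter n (aut_sym T)).
Proof.
by elim: n => // n IH x; rewrite iterSr /= aut_funK IH.
Qed.

Lemma aut_iterKV T n : cancel (iter n (aut_sym T)) (iter n T).
Proof. exact: (@aut_iterK (aut_sym T)). Qed.

Lemma aut_pow_nat T (n : nat) x : aut_pow T n%:Z x = iter n T x.
Proof. by []. Qed.

Lemma aut_pow1D T k x : aut_pow T (1 + k) x = T (aut_pow T k x).
Proof.
case: k => [m|[|m]]; [by []|by rewrite /= aut_invK|].
rewrite (_ : 1 + Negz m.+1 = Negz m); last by lia.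
by rewrite /= aut_invK.
Qed.

Lemma aut_powD T k l x : aut_pow T (k + l) x = aut_pow T k (aut_pow T l x).
Proof.
elim/int_ind: k => [|m IH|m IH]; first by rewrite add0r.
  by rewrite intS -addrA !aut_pow1D IH.
apply: (can_inj (aut_funK T)).
rewrite -!aut_pow1D (_ : 1 + (- m.+1%:Z + l) = - m%:Z + l); last by lia.
rewrite (_ : 1 - m.+1%:Z = - m%:Z); [exact: IH|by lia].
Qed.

Lemma aut_powN T k x : aut_pow T (- k) (aut_pow T k x) = x.
Proof. by rewrite -aut_powD addNr. Qed.

Lemma aut_pow_period T (k : nat) j x :
  iter k T x = x -> iter k T (aut_pow T j x) = aut_pow T j x.
Proof.
by move=> xk; rewrite -aut_pow_nat -aut_powD addrC aut_powD aut_pow_nat xk.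
Qed.

Lemma aut_pow_mod T (k : nat) j x : (0 < k)%N -> iter k T x = x ->
  aut_pow T j x = iter `|(j %% k)%Z| T x.
Proof.
move=> k0 xk.
have mulk (i : int) : aut_pow T (i * k%:Z) x = x.
  elim/int_ind: i => [|i IH|i IH]; first by rewrite mul0r.
    by rewrite intS mulrDl mul1r aut_powD IH.
  rewrite -(aut_pow_period (- i.+1%:Z * k%:Z) xk) -aut_pow_nat -aut_powD.
  rewrite -[RHS]IH.
  by congr (aut_pow T _ x); rewrite intS; ring.
rewrite [in LHS](divz_eq j k%:Z) addrC aut_powD mulk.
by rewrite -aut_pow_nat gez0_abs // modz_ge0 //; lia.
Qed.

Lemma aut_powVE T (n : nat) x : aut_pow T (- n%:Z) x = iter n (aut_sym T) x.
Proof. by case: n => //= n; rewrite NegzE. Qed.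

Lemma measurable_pow_preimage T (k : int) E :
  measurable E -> measurable (aut_pow T k @^-1` E).
Proof.
by case: k => m mE; [exact: (@measurable_iter_preimage T m)|
  exact: (@measurable_iter_preimage (aut_sym T) m.+1)].
Qed.

Lemma mu_pow_preimage T (k : int) E :
  measurable E -> mu (aut_pow T k @^-1` E) = mu E.
Proof.
by case: k => m mE; [exact: (@mu_iter_preimage T m)|
  exact: (@mu_iter_preimage (aut_sym T) m.+1)].
Qed.

Lemma aut_orbit_refl T x : aut_orbit T x x.
Proof. by exists 0. Qed.

Lemma aut_orbit_pow T k x : aut_orbit T x (aut_pow T k x).
Proof. by exists k. Qed.

Lemma iter_sub_period T i j x : (i <= j)%N -> iter i T x = iter j T x ->
  iter (j - i) T x = x.
Proof.
move=> ij; rewrite -{1}(subnKC ij) iterD => e.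
by apply: (can_inj (@aut_iterK T i)).
Qed.

(** All powers of [T] at [x] reduce modulo [p], and two equal ones among the first
    [p] would give a smaller period. *)
Lemma card_orbit_period T (p : nat) x : (0 < p)%N -> iter p T x = x ->
  (forall i, (0 < i < p)%N -> iter i T x <> x) -> aut_orbit T x #= `I_p.
Proof.
move=> p0 xp nx.
rewrite (_ : aut_orbit T x = (fun i => iter i T x) @` `I_p).
  apply: inj_card_eq => i j; rewrite !inE /= => ip jp.
  wlog ij : i j ip jp / (i <= j)%N => [h e|].
    by case: (leqP i j) => [|/ltnW] ij; [|symmetry]; apply: h.
  move=> /(iter_sub_period ij) e; apply/eqP; rewrite eqn_leq ij leqNgt.
  by apply/negP => ij'; apply: (nx _ _ e); lia.
apply/seteqP; split => [_ [j _ <-]|_ [i _ <-]]; last exact: (aut_orbit_pow T i).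
rewrite /= (aut_pow_mod _ p0 xp); exists `|(j %% p)%Z|%N => //=.
have := ltz_mod j (d := p%:Z); have := modz_ge0 j (d := p%:Z); lia.
Qed.

(** A finite orbit has a period by the pigeonhole principle, and the orbit
    determines its least period. *)
Lemma period_card_orbit T (n : nat) x : aut_orbit T x #= `I_n ->
  [/\ (0 < n)%N, iter n T x = x & forall i, (0 < i < n)%N -> iter i T x <> x].
Proof.
move=> cn.
have ex : exists p, (0 < p)%N && `[< iter p T x = x >].
  apply: contrapT => nper; apply: infinite_nat.
  rewrite (_ : [set: nat] = (fun i => iter i T x) @^-1` aut_orbit T x); last first.
    by apply/seteqP; split => // i _; exact: (aut_orbit_pow T i).
  apply: finite_preimage => [i j _ _|]; last by apply/finite_setP; exists n.
  wlog ij : i j / (i <= j)%N => [h e|].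
    by case: (leqP i j) => [|/ltnW] ij; [|symmetry]; apply: h.
  move=> /(iter_sub_period ij) e; apply/eqP; rewrite eqn_leq ij leqNgt.
  apply/negP => ij'; apply: nper; exists (j - i)%N.
  by rewrite subn_gt0 ij'; apply/asboolP.
case: (ex_minnP ex) => p /andP[p0 /asboolP xp] pmin.
have np i : (0 < i < p)%N -> iter i T x <> x.
  move=> /andP[i0 ip] xi.
  by have := pmin i; rewrite i0 asboolT // leqNgt ip => /(_ isT).
suff <- : p = n by [].
apply/card_eq_II; apply: card_eq_trans cn; rewrite card_eq_sym.
exact: card_orbit_period.
Qed.

(** Null sets are carried to null sets by each of the countably many powers of
    [T], so a property that holds almost everywhere holds along almost every
    orbit: almost-everywhere hypotheses become pointwise ones on a set of
    whole orbits. *)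
Lemma ae_orbit T (P : X -> Prop) :
  {ae mu, forall x, P x} -> {ae mu, forall x, forall k, P (aut_pow T k x)}.
Proof.
move=> [N [mN N0 PN]].
have neg k : mu.-negligible (aut_pow T k @^-1` N).
  exists (aut_pow T k @^-1` N); split => //; first exact: measurable_pow_preimage.
  by rewrite mu_pow_preimage.
have := negligibleU (negligible_bigcup (fun n : nat => neg n))
  (negligible_bigcup (fun n : nat => neg (Negz n))).
apply: negligibleS => x /= /existsNP[k nP].
have {nP} /PN Nk : (~` [set x | P x]) (aut_pow T k x) by [].
by case: k Nk => m Nk; [left|right]; exists m.
Qed.

Lemma ae_preimage T (P : X -> Prop) :
  {ae mu, forall x, P x} -> {ae mu, forall x, P (T x)}.
Proof.
move=> /(ae_orbit T); apply: filterS => x /(_ 1); exact.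
Qed.

(** The measurable form of [ae_orbit]: what is built from [T] on [X0] stays
    in [X0]. *)
Lemma ae_invariant_core T (P : X -> Prop) : {ae mu, forall x, P x} ->
  exists X0 : set X, [/\ measurable X0, {ae mu, forall x, X0 x},
    forall k x, X0 x -> X0 (aut_pow T k x) & forall x, X0 x -> P x].
Proof.
move=> [N [mN N0 PN]].
exists [set x | forall k, ~ N (aut_pow T k x)]; split.
- rewrite (_ : [set _ | _] = ~` (\bigcup_k (aut_pow T k @^-1` N))).
    apply/measurableC/countable_bigcupT_measurable; first exact: countableP.
    by move=> k; exact: measurable_pow_preimage.
  apply/seteqP; split => x /=; first by move=> h [k _ /h].
  by move=> h k Nk; apply: h; exists k.
- apply: (@ae_orbit T (fun x => ~ N x)).
  by exists N; split => // x /= /contrapT.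
- by move=> k x h l; rewrite -aut_powD.
- move=> x /(_ 0) /= Nx; apply: contrapT => nP.
  by apply/Nx/PN.
Qed.

End Automorphisms.

(** * Functions with measurable levels *)

(** All subsets of the target are allowed, so that any operation may be applied
    to the values of such functions with no measurability condition on it. *)
Definition measurable_levels (d : measure_display) (X : measurableType d)
  (I : Type) (f : X -> I) := forall P : set I, measurable (f @^-1` P).

Section MeasurableLevels.
Context (d : measure_display) (X : measurableType d).

Lemma levels_fiber (I : countType) (f : X -> I) :
  (forall i, measurable [set x | f x = i]) -> measurable_levels f.
Proof.
move=> mf P.
rewrite (_ : _ @^-1` _ =
  \bigcup_(i in [set: I]) ([set x | P i] `&` [set x | f x = i])).
  apply: countable_bigcupT_measurable => [|i]; first exact: countableP.
  apply: measurableI => //.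
  have [Pi|Pi] := pselect (P i).
    by rewrite (_ : [set _ | _] = setT) //; apply/seteqP; split => x.
  by rewrite (_ : [set _ | _] = set0) //; apply/seteqP; split => x.
apply/seteqP; split => x /=; first by move=> h; exists (f x).
by move=> [i _ [/= Pi ->]].
Qed.

Lemma levels_comp (I J : Type) (f : X -> I) (g : I -> J) :
  measurable_levels f -> measurable_levels (g \o f).
Proof. by move=> mf P; rewrite comp_preimage; exact: mf. Qed.

Lemma levels_op (I J : countType) (K : Type) (f : X -> I) (g : X -> J)
    (h : I -> J -> K) : measurable_levels f -> measurable_levels g ->
  measurable_levels (fun x => h (f x) (g x)).
Proof.
move=> mf mg.
apply: (@levels_comp _ _ (fun x => (f x, g x)) (fun p => h p.1 p.2)).
apply: levels_fiber => -[i j].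
rewrite (_ : [set _ | _] = f @^-1` [set i] `&` g @^-1` [set j]).
  exact: measurableI.
by apply/seteqP; split => x /= [-> ->].
Qed.

Lemma levels_cst (I : Type) (i : I) : measurable_levels (fun _ : X => i).
Proof.
move=> P; have [Pi|Pi] := pselect (P i).
  by rewrite (_ : _ @^-1` _ = setT) //; apply/seteqP; split => x.
by rewrite (_ : _ @^-1` _ = set0) //; apply/seteqP; split => x.
Qed.

Lemma levels_asbool (A : set X) :
  measurable A -> measurable_levels (fun x => `[< A x >]).
Proof.
move=> mA; apply: levels_fiber => -[].
  rewrite (_ : [set _ | _] = A) //.
  by apply/seteqP; split => x /=; move=> /asboolP.
rewrite (_ : [set _ | _] = ~` A); first exact: measurableC.
by apply/seteqP; split => x /= h; [exact/asboolPn/negbT|exact/negbTE/asboolPn].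
Qed.

Lemma levels_sum (I : Type) (r : seq I) (f : I -> X -> nat) :
  (forall i, measurable_levels (f i)) ->
  measurable_levels (fun x => (\sum_(i <- r) f i x)%N).
Proof.
move=> mf; elim: r => [|i r IH].
  rewrite (_ : (fun x => _) = fun=> 0%N); first exact: levels_cst.
  by apply/funext => x; rewrite big_nil.
rewrite (_ : (fun x => _) = fun x => (f i x + \sum_(i <- r) f i x)%N).
  exact: (levels_op addn).
by apply/funext => x; rewrite big_cons.
Qed.

Lemma levels_measurable_fun d' (Y : measurableType d') (I : Type) (f : X -> I)
    (g : I -> Y) : measurable_levels f -> measurable_fun setT (g \o f).
Proof.
by move=> mf _ P mP; rewrite setTI comp_preimage; exact: mf.
Qed.

End MeasurableLevels.

(** * Integrable cocycles and Kac's formula *)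

Section IntegrableCocycles.
Context (R : realType) (d : measure_display) (X : measurableType d).
Context (mu : probability X R).
Implicit Types (T U V : automorphism mu) (A B E : set X) (x y : X).

Lemma mu_le A B :
  measurable A -> measurable B -> A `<=` B -> (mu A <= mu B)%E.
Proof. by move=> mA mB AB; apply: le_measure AB; rewrite inE. Qed.

Definition int_integrable (c : X -> int) : Prop :=
  mu.-integrable [set: X] (fun x => ((c x)%:~R : R)%:E).

Lemma int_integrable_levels c : int_integrable c -> measurable_levels c.
Proof.
move=> /measurable_int mc; apply: levels_fiber => i.
rewrite (_ : [set _ | _] =
  setT `&` (fun x => ((c x)%:~R : R)%:E) @^-1` [set i%:~R%:E]).
  by apply: mc => //; exact: emeasurable_set1.
by rewrite setTI; apply/seteqP; split => x /= => [->//|[] /intr_inj].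
Qed.

Lemma int_integrableD c e : int_integrable c -> int_integrable e ->
  int_integrable (fun x => c x + e x).
Proof.
move=> ic ie; rewrite /int_integrable.
rewrite (_ : (fun x => _) =
  (fun x => ((c x)%:~R : R)%:E) \+ (fun x => ((e x)%:~R : R)%:E))%E.
  exact: integrableD.
by apply/funext => x /=; rewrite -EFinD intrD.
Qed.

Lemma int_integrableN c : int_integrable c -> int_integrable (fun x => - c x).
Proof.
move=> /integrableN; congr (mu.-integrable _ _).
by apply/funext => x /=; rewrite mulrNz.
Qed.

Lemma int_integrable0 : int_integrable (fun _ => 0).
Proof. exact: integrable0. Qed.

Lemma integral_aut T (f : X -> \bar R) : measurable_fun [set: X] f ->
  (forall x, 0 <= f x)%E -> (\int[mu]_x f (T x) = \int[mu]_x f x)%E.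
Proof.
move=> mf f0; have := ge0_integral_pushforward (measurable_aut_fun T) mu
  measurableT mf (fun y _ => f0 y).
rewrite preimage_setT => <-; apply: eq_measure_integral => [|mT E mE _].
  exact: measurable_aut_fun.
exact: aut_preserving.
Qed.

Lemma int_integrable_aut T c : int_integrable c -> int_integrable (c \o T).
Proof.
move=> /integrableP[mc fc]; apply/integrableP; split.
  exact: (measurableT_comp mc (measurable_aut_fun T)).
move: fc; rewrite -(integral_aut T) //.
exact: measurableT_comp.
Qed.

(** The layer-cake formula: [h] is the sum over [k] of the indicators of
    [k < h]. *)
Lemma integral_nat_tail (h : X -> nat) : measurable_levels h ->
  (\int[mu]_x ((h x)%:R : R)%:E =
   \sum_(0 <= k <oo) mu [set x | (k < h x)%N])%E.
Proof.
move=> mh.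
have ind k : measurable [set x | (k < h x)%N] := mh [set m | (k < m)%N].
rewrite (_ : (fun x => _) = fun x =>
    (\sum_(0 <= k <oo) (\1_[set x | (k < h x)%N] x : R)%:E)%E); last first.
  apply/funext => x; rewrite (nneseries_split 0 (h x)); last first.
    by move=> k _; rewrite lee_fin.
  rewrite eseries0 ?adde0 ?add0n; last first.
    move=> i hi _; rewrite indicE memNset //= => hx.
    by move: hi; rewrite ?add0n leqNgt hx.
  rewrite (eq_big_nat _ _ (F2 := fun=> 1%E)) => [|i /andP[_ ih]]; last first.
    by rewrite indicE mem_set.
  by rewrite sumEFin big_const_nat subn0 iter_addr_0.
rewrite integral_nneseries //.
  by apply: eq_eseriesr => k _; rewrite integral_indic // setIT.
move=> k; apply/measurable_EFinP; exact: measurable_indic.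
Qed.

Lemma int_integrable_tail c : measurable_levels c ->
  int_integrable c <-> (\sum_(0 <= k <oo) mu [set x | (k < `|c x|)%N] < +oo)%E.
Proof.
move=> mc; rewrite -(@integral_nat_tail (fun x => `|c x|%N)); last first.
  exact: (levels_comp absz).
have E : (\int[mu]_x `|((c x)%:~R : R)%:E| = \int[mu]_x ((`|c x|%N)%:R : R)%:E)%E.
  apply: eq_integral => x _.
  by rewrite abse_EFin -intr_norm -abszE.
split => [/integrableP[_]|fc]; rewrite -?E //.
apply/integrableP; split; last by rewrite E.
exact: (levels_measurable_fun (fun z : int => (z%:~R : R)%:E)).
Qed.

(** By Borel-Cantelli: the sum over [k] of the measures of
    [k < |c (T^k x)|] is the integral of [|c|], since [T^k] preserves the
    measure. So only finitely many points of a forward orbit are displaced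
    past its origin. *)
Lemma ae_cocycle_le_time T c : int_integrable c ->
  {ae mu, forall x, exists K, forall k, (K <= k)%N -> (`|c (iter k T x)| <= k)%N}.
Proof.
move=> ic; have mc := int_integrable_levels ic.
have := (int_integrable_tail mc).1 ic.
set E := fun k : nat => [set x | (k < `|c x|)%N].
have mE k : measurable (E k) by exact: (levels_comp absz mc [set m | (k < m)%N]).
rewrite -/(E _) => fc.
have mTE k : measurable (iter k T @^-1` E k) by exact: measurable_iter_preimage.
have F0 : mu (lim_sup_set (fun k => iter k T @^-1` E k)) = 0%E.
  apply: lim_sup_set_cvg0 => //.
  rewrite (_ : (\sum_(0 <= n <oo) _)%E = (\sum_(0 <= k <oo) mu (E k))%E) //.
  by apply: eq_eseriesr => k _; exact: mu_iter_preimage.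
exists (lim_sup_set (fun k => iter k T @^-1` E k)); split => //.
  by apply: bigcapT_measurable => k; exact: bigcup_measurable.
move=> x /= nx K _; apply: contrapT => nK; apply: nx.
exists K => k Kk; rewrite leqNgt; apply/negP => ck; apply: nK.
by exists k.
Qed.

Definition no_return T A (k : nat) : set X :=
  [set x | A x /\ forall j, (0 < j <= k)%N -> ~ A (iter j T x)].

Lemma measurable_no_return T A k : measurable A -> measurable (no_return T A k).
Proof.
move=> mA; rewrite (_ : no_return T A k =
  A `&` \bigcap_(j in [set j | (0 < j <= k)%N]) ~` (iter j T @^-1` A)) //.
apply: measurableI => //; apply: bigcap_measurableType => j _.
exact/measurableC/measurable_iter_preimage.
Qed.

(** Kac's formula: the sets [T^k (no_return T A k)] sort the points by the time
    [k] elapsed since their last visit to [A], so they are disjoint. *)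
Lemma sum_no_return_le1 T A : measurable A ->
  (\sum_(0 <= k <oo) mu (no_return T A k) <= 1)%E.
Proof.
move=> mA.
pose V k := iter k (aut_sym T) @^-1` (no_return T A k).
have mV k : measurable (V k).
  exact/measurable_iter_preimage/measurable_no_return.
rewrite (_ : (\sum_(0 <= k <oo) _)%E = (\sum_(0 <= k <oo) mu (V k))%E); last first.
  apply: eq_eseriesr => k _; rewrite mu_iter_preimage //.
  exact: measurable_no_return.
rewrite -measure_semi_bigcup //; last exact: bigcupT_measurable.
  by apply: probability_le1; exact: bigcupT_measurable.
apply/trivIsetP => i j _ _.
wlog ij : i j / (i < j)%N => [h|_].
  rewrite neq_ltn => /orP[] ij; last rewrite setIC.
    by apply: (h _ _ ij); rewrite neq_ltn ij.
  by apply: (h _ _ ij); rewrite neq_ltn ij.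
apply/seteqP; split => // y [/= [Ai _] [_ /(_ (j - i)%N) Aj]].
apply: Aj; first by lia.
by rewrite -{2}(subnK (ltnW ij)) iterD aut_iterKV.
Qed.

(** Poincare recurrence: the points of [A] that never return lie in every
    [no_return T A k], and the measures of these sets have a finite sum. *)
Lemma ae_return T A : measurable A ->
  {ae mu, forall x, A x -> exists k, returns T A x k}.
Proof.
move=> mA; pose W := \bigcap_k no_return T A k.
have mW : measurable W.
  by apply: bigcapT_measurable => k; exact: measurable_no_return.
exists W; split => //.
- apply/eqP; rewrite eq_le measure_ge0 andbT leNgt; apply/negP => W0.
  have : (\sum_(0 <= k <oo) mu W <= 1)%E.
    apply: le_trans (sum_no_return_le1 T mA); apply: lee_nneseries => // k _.
    by apply: mu_le => // [|x]; [exact: measurable_no_return|exact].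
  have Wfin : mu W \is a fin_num by exact: fin_num_measure.
  rewrite -(fineK Wfin) lte_fin in W0.
  rewrite leNgt => /negP; apply; rewrite -(fineK Wfin).
  (* more than [1 / mu W] terms equal to [mu W] already exceed 1 *)
  pose N := (Num.trunc (fine (mu W))^-1).+1.
  apply: (@lt_le_trans _ _ (\sum_(0 <= k < N) (fine (mu W))%:E)%E).
    rewrite sumEFin sumr_const_nat subn0 lte_fin -mulr_natl -ltr_pdivrMr //.
    by rewrite div1r; exact: truncnS_gt.
  by apply: nneseries_lim_ge => n _ _; rewrite lee_fin ltW.
- move=> x /= /not_implyP[Ax nk] k _; split => // j /andP[j0 _] Aj.
  by apply: nk; exists j; rewrite /returns j0; apply/asboolP.
Qed.

Definition return_steps T A x : nat := if `[< A x >] then return_time T A x else 0.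

Lemma return_stepsS T A x m : return_steps T A x = m.+1 <->
  no_return T A m x /\ A (iter m.+1 T x).
Proof.
rewrite /return_steps; case: asboolP => Ax; last by split => // -[[]].
rewrite /return_time; case: pselect => [ex|nex]; last first.
  split => // -[_ Am]; exfalso; apply: nex.
  by exists m.+1; apply/andP; split => //; apply/asboolP.
case: ex_minnP => k /andP[k0 /asboolP Ak] kmin; split => [km|[[_ nA] Am]].
  rewrite km in Ak kmin; split => //; split => // j /andP[j0 jm] Aj.
  have : returns T A x j by apply/andP; split => //; apply/asboolP.
  by move=> /kmin; rewrite ltnNge jm.
apply/eqP; rewrite eqn_leq; apply/andP; split.
  by apply: kmin; apply/andP; split => //; apply/asboolP.
by rewrite ltnNge; apply/negP => km; apply: (nA k) => //; rewrite k0.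
Qed.

Lemma levels_return_steps T A :
  measurable A -> measurable_levels (return_steps T A).
Proof.
move=> mA; have mS m : measurable [set x | return_steps T A x = m.+1].
  rewrite (_ : [set _ | _] = no_return T A m `&` iter m.+1 T @^-1` A).
    apply: measurableI; first exact: measurable_no_return.
    exact: measurable_iter_preimage.
  by apply/seteqP; split => x /return_stepsS.
apply: levels_fiber => -[|m //].
rewrite (_ : [set _ | _] = ~` \bigcup_m [set x | return_steps T A x = m.+1]).
  exact/measurableC/bigcupT_measurable.
apply/seteqP; split => x /=; first by move=> x0 [m _] /=; rewrite x0.
by case E : (return_steps T A x) => [//|m] h; exfalso; apply: h; exists m.
Qed.

(** A return time above [k] means no return up to time [k], so the layer-cake
    formula and Kac's bound apply. *)
Lemma integrable_return_steps T A :
  measurable A -> int_integrable (fun x => (return_steps T A x)%:Z).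
Proof.
move=> mA; apply/int_integrable_tail.
  exact/(levels_comp Posz)/levels_return_steps.
apply: (@le_lt_trans _ _ 1%E); last exact: ltry.
apply: le_trans (sum_no_return_le1 T mA); apply: lee_nneseries => // k _.
apply: mu_le.
- exact: (levels_return_steps _ mA [set m | (k < m)%N]).
- exact: measurable_no_return.
- move=> x /=; case E: return_steps => [//|m] km.
  have [[Ax nA] _] := (return_stepsS T A x m).1 E.
  by split => // j /andP[j0 jk]; apply: nA; rewrite j0 (leq_trans jk).
Qed.

End IntegrableCocycles.

(** * The L1 full group and the induced transformation *)

Section L1Automorphisms.
Context (R : realType) (d : measure_display) (X : measurableType d).
Context (mu : probability X R).
Implicit Types (T U V : automorphism mu) (A B E : set X) (x y : X).

Lemma L1_full_group_cocycle T U (c : X -> int) :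
  is_cocycle T U c -> int_integrable mu c -> L1_full_group T U.
Proof.
move=> cU ic; split; last by exists c.
by apply: filterS cU => x ->; exact: aut_orbit_pow.
Qed.

Lemma is_cocycle_comp T U V (c e : X -> int) :
  is_cocycle T U c -> is_cocycle T V e ->
  is_cocycle T (aut_comp U V) (fun x => c (V x) + e x).
Proof.
move=> /(ae_preimage V) cU eV; apply: filterS2 cU eV => x /= -> Vx.
by rewrite aut_powD -Vx.
Qed.

Lemma is_cocycle_sym T U (c : X -> int) :
  is_cocycle T U c -> is_cocycle T (aut_sym U) (fun x => - c (aut_inv U x)).
Proof.
move=> /(ae_preimage (aut_sym U)); apply: filterS => x /=; rewrite aut_invK => h.
by rewrite [X in aut_pow _ _ X]h aut_powN.
Qed.

Lemma L1_full_group_comp T U V :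
  L1_full_group T U -> L1_full_group T V -> L1_full_group T (aut_comp U V).
Proof.
move=> [_ [c cU ic]] [_ [e eV ie]].
apply: L1_full_group_cocycle (is_cocycle_comp cU eV) _.
exact/int_integrableD/ie/(int_integrable_aut V ic).
Qed.

Lemma L1_full_group_sym T U :
  L1_full_group T U -> L1_full_group T (aut_sym U).
Proof.
move=> [_ [c cU ic]]; apply: L1_full_group_cocycle (is_cocycle_sym cU) _.
exact/int_integrableN/(int_integrable_aut (aut_sym U) ic).
Qed.

Lemma L1_full_group_id T : L1_full_group T (aut_id mu).
Proof.
apply: (@L1_full_group_cocycle _ _ (fun=> 0)); last exact: int_integrable0.
exact: aeW.
Qed.

Section StepBijection.
Context (T : automorphism mu) (s : X -> nat) (V V' : X -> X).
Hypotheses (ms : measurable_levels s) (Vs : forall x, V x = iter (s x) T x).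
Hypotheses (VK : cancel V V') (VK' : cancel V' V).

Let piece E k := [set x | s x = k] `&` iter k T @^-1` E.

Let measurable_piece E k : measurable E -> measurable (piece E k).
Proof.
move=> mE; apply: measurableI; first exact: ms [set k].
exact: measurable_iter_preimage.
Qed.

Let preimageE E : V @^-1` E = \bigcup_k piece E k.
Proof.
apply/seteqP; split => x /=; rewrite Vs; first by move=> Ex; exists (s x).
by move=> [k _ [/= ->]].
Qed.

Lemma measurable_step : measurable_fun setT V.
Proof.
move=> _ E mE; rewrite setTI preimageE.
by apply: bigcupT_measurable => k; exact: measurable_piece.
Qed.

(** A bijection that moves each point along its own [T]-orbit cuts the space
    into countably many pieces, on each of which it is a power of [T]. *)
Lemma mu_step E : measurable E -> mu (V @^-1` E) = mu E.
Proof.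
move=> mE; have mp k := measurable_piece k mE.
pose G k := iter k (aut_sym T) @^-1` piece E k.
have mG k : measurable (G k) by exact: measurable_iter_preimage.
have VG k y : G k y -> V (iter k (aut_sym T) y) = y.
  by move=> [/= sk _]; rewrite Vs sk aut_iterKV.
have EG : E = \bigcup_k G k.
  apply/seteqP; split => y /=; last by move=> [k _ [_ /=]]; rewrite aut_iterKV.
  move=> Ey; exists (s (V' y)) => //.
  rewrite /G /piece /= aut_iterKV.
  by rewrite -{2}(VK' y) Vs aut_iterK.
rewrite preimageE [in RHS]EG !measure_semi_bigcup //.
- by apply: eq_eseriesr => k _; exact/esym/mu_iter_preimage.
- apply/trivIsetP => k l _ _ kl; apply/seteqP; split => // y [Gk Gl].
  move/eqP: kl; apply; case: (Gk) (Gl) => [/= <- _] [/= <- _].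
  by congr s; apply: (can_inj VK); rewrite !VG.
- exact: bigcupT_measurable.
- apply/trivIsetP => k l _ _ /eqP kl; apply/seteqP; split => // y [[/= sk _] [/= sl _]].
  by apply: kl; rewrite -sk.
- exact: bigcupT_measurable.
Qed.

End StepBijection.

Definition next_visit T A x k :=
  [/\ (0 < k)%N, A (iter k T x) & forall j, (0 < j < k)%N -> ~ A (iter j T x)].

Lemma next_visit_unique T A x k l :
  next_visit T A x k -> next_visit T A x l -> k = l.
Proof.
move=> [k0 Ak nk] [l0 Al nl].
case: (ltngtP k l) => // h; exfalso.
- by apply: (nl k) => //; rewrite k0.
- by apply: (nk l) => //; rewrite l0.
Qed.

(** The graph of the induced transformation. It is stated at a point because
    every later argument happens inside a single orbit. *)
Definition induced_at T A x y :=
  (A x -> exists2 k, next_visit T A x k & y = iter k T x) /\ (~ A x -> y = x).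

Lemma induced_at_unique T A x y z :
  induced_at T A x y -> induced_at T A x z -> y = z.
Proof.
move=> [yA yN] [zA zN]; have [Ax|Ax] := pselect (A x); last by rewrite yN ?zN.
have [k nk ->] := yA Ax; have [l nl ->] := zA Ax.
by rewrite (next_visit_unique nk nl).
Qed.

Lemma induced_at_in T A x y : A x -> induced_at T A x y -> A y.
Proof. by move=> Ax [/(_ Ax)[k [_ Ak _] ->]]. Qed.

Lemma induced_at_orbit T A x y : induced_at T A x y -> aut_orbit T x y.
Proof.
move=> [yA yN]; have [Ax|Ax] := pselect (A x).
  by have [k _ ->] := yA Ax; exact: (aut_orbit_pow T k).
by rewrite yN //; exact: aut_orbit_refl.
Qed.

Lemma return_steps_next T A x m : return_steps T A x = m.+1 <->
  A x /\ next_visit T A x m.+1.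
Proof.
rewrite return_stepsS; split.
  by move=> [[Ax nA] Am]; split => //; split => // j jm; apply: nA; lia.
by move=> [Ax [_ Am nA]]; split => //; split => // j jm; apply: nA; lia.
Qed.

(** The first-return map on [X0], the identity elsewhere: with [X0] an
    invariant set of recurrent points this is a bijection of the whole space. *)
Definition jump T A (X0 : set X) x : X :=
  iter (if `[< X0 x >] then return_steps T A x else 0) T x.

Lemma return_steps_gt0 T A x :
  A x -> (exists k, returns T A x k) -> (0 < return_steps T A x)%N.
Proof.
move=> Ax ret; rewrite /return_steps asboolT // /return_time.
by case: pselect => // ex; case: ex_minnP => k /andP[].
Qed.

(** The first return of the reversed transformation undoes the first return:
    between two consecutive visits to [A] there is none, in either
    direction. *)
Lemma jumpK T A (X0 : set X) : (forall k x, X0 x -> X0 (aut_pow T k x)) ->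
  (forall x, X0 x -> A x -> exists k, returns T A x k) ->
  cancel (jump T A X0) (jump (aut_sym T) A X0).
Proof.
move=> inv ret x; rewrite /jump; case: (asboolP (X0 x)) => [X0x|nX0x]; last first.
  by rewrite /=; case: asboolP.
case E : (return_steps T A x) => [|m].
  rewrite /= asboolT //; suff nAx : ~ A x by rewrite /return_steps asboolF.
  by move=> Ax; have := return_steps_gt0 Ax (ret x X0x Ax); rewrite E.
have [Ax [_ Am nA]] := (return_steps_next T A x m).1 E.
rewrite asboolT; last exact: (inv m.+1).
suff -> : return_steps (aut_sym T) A (iter m.+1 T x) = m.+1 by rewrite aut_iterK.
apply/return_steps_next; split => //; split => //; first by rewrite aut_iterK.
move=> j /andP[j0 jm].
rewrite -(subnK (ltnW jm)) addnC iterD aut_iterK; apply: nA; lia.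
Qed.

Lemma levels_core_steps T A (X0 : set X) : measurable A -> measurable X0 ->
  measurable_levels (fun x => if `[< X0 x >] then return_steps T A x else 0%N).
Proof.
move=> mA mX0; apply: (levels_op (fun (b : bool) k => if b then k else 0%N)).
  exact: levels_asbool.
exact: levels_return_steps.
Qed.

(** Off a null set the first-return map is a bijection, because almost every
    point of [A] comes back both in the future and in the past, and Kac's
    formula makes it an element of the L1 full group. Fixing the points
    outside a conull set of whole orbits makes it a bijection everywhere. *)
Lemma induced_automorphism T A : measurable A ->
  exists S : automorphism mu, L1_full_group T S /\
    {ae mu, forall x, induced_at T A x (S x)}.
Proof.
move=> mA.
have [X0 [mX0 aeX0 inv ret]] := ae_invariant_core T
  (filterI (ae_return T mA) (ae_return (aut_sym T) mA)).
have inv' k x : X0 x -> X0 (aut_pow (aut_sym T) k x).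
  by case: k => m; [rewrite /= -aut_powVE|]; [exact: inv|exact: (inv m.+1)].
have jK := jumpK inv (fun x X0x => (ret x X0x).1).
have jK' : cancel (jump (aut_sym T) A X0) (jump T A X0).
  exact: (jumpK (T := aut_sym T) inv' (fun x X0x => (ret x X0x).2)).
have ls := levels_core_steps T mA mX0.
have ls' := levels_core_steps (aut_sym T) mA mX0.
pose S := Automorphism jK jK' (measurable_step ls (fun=> erefl))
  (measurable_step ls' (fun=> erefl)) (mu_step ls (fun=> erefl) jK jK').
exists S; split.
  apply: (@L1_full_group_cocycle _ _ (fun x => (return_steps T A x)%:Z)).
    by apply: filterS aeX0 => x X0x; rewrite /S /= /jump asboolT.
  exact: integrable_return_steps.
apply: filterS aeX0 => x X0x; rewrite /S /= /jump asboolT //; split => [Ax|nAx].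
  have := return_steps_gt0 Ax ((ret x X0x).1 Ax).
  case E : return_steps => [//|m] _.
  by exists m.+1 => //; exact: ((return_steps_next T A x m).1 E).2.
by rewrite /return_steps asboolF.
Qed.

Lemma induced_aut_at T A x y : mu A <> 0%E -> induced_at T A x y ->
  induced_aut T A x = y.
Proof.
move=> A0 [yA yN]; rewrite /induced_aut.
case: asboolP => [[_ Ax]|nAx]; last by rewrite yN // => Ax; apply: nAx.
have [k nk ->] := yA Ax; have [k0 _ _] := nk.
have : return_steps T A x = k.
  by rewrite -(prednK k0); apply/return_steps_next; rewrite prednK.
by rewrite /return_steps asboolT // => ->.
Qed.

End L1Automorphisms.

(** * Aperiodicity *)

Section Freeness.
Context (R : realType) (d : measure_display) (X : measurableType d).
Context (mu : probability X R).
Implicit Types (T U V : automorphism mu) (A B E : set X) (x y : X).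

(** The diagonal of a standard Borel space is Borel: countably many sets
    separate its points. *)
Lemma measurable_fixed_points (g : X -> X) : standard_borel R X ->
  measurable_fun setT g -> measurable [set x | g x = x].
Proof.
move=> [Y [f [hY [D cD dD] bf mf]]] mg.
have [f' fK f'K] := bf.
pose O (q : Y) (m : nat) := interior (ball q (m.+1%:R^-1 : R)).
have mE q m : measurable (f @^-1` O q m).
  apply/mf; rewrite image_preimage.
    by apply: sub_gen_smallest; exact: open_interior.
  by apply/seteqP; split => // y _; exists (f' y).
pose G (q : D) := \bigcup_m
  ((f @^-1` O (val q) m) `\` (g @^-1` (f @^-1` O (val q) m))).
rewrite (_ : [set x | g x = x] = ~` \bigcup_q G q).
  apply/measurableC/countable_bigcupT_measurable.
    by rewrite (eq_countable (card_setT D)).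
  move=> q; apply: bigcupT_measurable => m; apply: measurableD => //.
  by rewrite -[g @^-1` _]setTI; exact: mg.
apply/seteqP; split => x /=.
  by move=> gx [q _ [m _ [/= fx]]]; rewrite gx.
move=> nG; apply: contrapT => /eqP gx; apply: nG.
have : f x != f (g x).
  by apply: contra gx => /eqP /(can_inj fK) xg; rewrite -xg.
move: hY; rewrite ball_hausdorff => /[apply] -[[r1 r2] /= /eqP r12].
have rpos : 0 < Num.min r1%:num r2%:num by rewrite lt_min !gt0.
have [m hm] : exists m : nat, (m.+1%:R^-1 : R) < Num.min r1%:num r2%:num.
  exists (Num.trunc (Num.min r1%:num r2%:num)^-1).
  by rewrite invf_plt ?posrE //; exact: truncnS_gt.
set e : R := m.+1%:R^-1 in hm.
have e0 : 0 < e by rewrite invr_gt0.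
have e20 : 0 < e / 2 by rewrite divr_gt0.
(* balls need not be open, hence the interiors; the radius [e / 2] leaves room
   for the ball around [q] to contain a neighbourhood of [f x] *)
have [q [/= qx Dq]] : (interior (ball (f x) (e / 2))) `&` D !=set0.
  apply: dD; last exact: open_interior.
  by exists (f x); exact: nbhsx_ballx.
have {}qx : ball (f x) (e / 2) q by exact: interior_subset qx.
exists (exist _ q (mem_set Dq)) => //; exists m => //; split => /=.
  apply: (@filterS _ _ _ (ball (f x) (e / 2))); last exact: nbhsx_ballx.
  move=> z xz; rewrite -/e (splitr e); apply: ball_triangle xz.
  exact: ball_sym.
move=> /interior_subset; rewrite -/e => qy.
suff : (set0 : set Y) q by [].
rewrite -r12; split.
  apply: le_ball qx; rewrite (le_trans _ (ltW (lt_le_trans hm _))) //.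
    by rewrite ler_pdivrMr // ler_peMr ?ler1n // ltW.
  by rewrite ge_min lexx.
apply: ball_sym; apply: le_ball qy.
by rewrite (le_trans (ltW hm)) // ge_min lexx orbT.
Qed.

(** Splitting a set of positive measure by nonatomicity, one of the two pieces
    has at most half its measure. *)
Lemma nonatomic_small_set (m : nat) : nonatomic mu ->
  exists E, [/\ measurable E, (0 < mu E)%E & ((2 ^ m)%:R%:E * mu E <= 1)%E].
Proof.
move=> na; elim: m => [|m [E [mE E0 Em]]].
  exists setT; rewrite probability_setT mul1e.
  by split.
have [F [mF FE F0 FltE]] := na E mE E0.
have mEF : measurable (E `\` F) by exact: measurableD.
have fin A : measurable A -> mu A \is a fin_num by move=> ?; exact: fin_num_measure.
have sumE : (mu E = mu (E `\` F) + mu F)%E.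
  by rewrite (measureDI mu mE mF) setIidr.
have key : fine (mu E) = fine (mu (E `\` F)) + fine (mu F).
  by rewrite sumE fineD // fin.
move: F0 FltE Em.
rewrite -(fineK (fin _ mE)) -(fineK (fin _ mF)) -EFinM !lte_fin lee_fin.
move=> F0 FltE Em.
have [hF|hF] := leP (2 * fine (mu F)) (fine (mu E)).
  exists F; split=> //; rewrite -(fineK (fin _ mF)) -?EFinM ?lte_fin ?lee_fin //.
  apply: le_trans Em; rewrite expnSr natrM -mulrA ler_wpM2l //.
exists (E `\` F); split=> //; rewrite -(fineK (fin _ mEF)) -?EFinM ?lte_fin ?lee_fin //.
  by lra.
apply: le_trans Em; rewrite expnSr natrM -mulrA ler_wpM2l //.
by lra.
Qed.

(** If [T^k] fixed almost every point, the union of [k] translates of a set of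
    measure less than [1/k] would be invariant, against ergodicity. *)
Lemma ergodic_aperiodic T : standard_borel R X -> nonatomic mu -> ergodic T ->
  {ae mu, forall x, forall k, (0 < k)%N -> iter k T x <> x}.
Proof.
move=> hX na eT.
suff per k : (0 < k)%N -> {ae mu, forall x, iter k T x <> x}.
  have : {ae mu, forall x, forall k, iter k.+1 T x <> x}.
    by apply/ae_foralln => k; exact: per.
  by apply: filterS => x h [//|k] _; exact: h.
move=> k0.
pose P := [set x | iter k T x = x].
have Ppow j x : P x -> P (aut_pow T j x) by exact: aut_pow_period.
have mP : measurable P.
  apply: measurable_fixed_points => // _ E mE; rewrite setTI.
  exact: measurable_iter_preimage.
have [P0|P1] : mu P = 0%E \/ mu P = 1%E.
- by apply: eT => // x Px _ [j _ <-]; exact: Ppow.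
- by exists P; split => // x /= /contrapT.
exfalso.
have [E [mE E0 Ek]] := nonatomic_small_set k na.
pose Q := P `&` \bigcup_(i in `I_k) (iter i T @^-1` E).
have mQ : measurable Q.
  by apply: measurableI => //; apply: bigcup_measurable => i _;
     exact: measurable_iter_preimage.
have Qinv x : Q x -> aut_orbit T x `<=` Q.
  move=> [Px [i /= ik Ex]] _ [j _ <-]; split; first exact: Ppow.
  exists `|((i%:Z - j) %% k)%Z|%N.
    rewrite /=; have := ltz_mod (i%:Z - j) (d := k%:Z).
    by have := modz_ge0 (i%:Z - j) (d := k%:Z); lia.
  rewrite /= -aut_pow_mod //; last exact: Ppow.
  by rewrite -aut_powD subrK.
have QE : P `&` E `<=` Q by move=> x [Px Ex]; split => //; exists 0%N.
have muPE : mu (P `&` E) = mu E.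
  apply/esym; rewrite (measureDI mu mE mP) setIC [X in (X + _)%E](_ : _ = 0%E).
    by rewrite add0e.
  apply/eqP; rewrite -measure_le0.
  apply: (@le_trans _ _ (mu (~` P))).
    by apply: mu_le; [exact: measurableD|exact: measurableC|move=> x []].
  by rewrite probability_setC // P1 subee.
have [Q0|Q1] := eT Q mQ Qinv.
  have : (mu E <= 0)%E.
    by rewrite -muPE -Q0; apply: mu_le => //; exact: measurableI.
  by rewrite leNgt E0.
have kE1 : (1 <= k%:R%:E * mu E)%E.
  rewrite -Q1; apply: (@le_trans _ _ (\sum_(i < k) mu (iter i T @^-1` E))%E).
    apply: (content_subadditive mu (F := fun i => iter i T @^-1` E)) => //.
      by move=> i _; exact: measurable_iter_preimage.
    by move=> x [_]; rewrite bigcup_mkord.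
  under eq_bigr do rewrite mu_iter_preimage //.
  rewrite -(fineK (fin_num_measure mu E mE)) sumEFin sumr_const card_ord.
  by rewrite -EFinM mulr_natl.
move: E0 Ek kE1; rewrite -(fineK (fin_num_measure mu E mE)) -!EFinM !lee_fin lte_fin.
move=> E0 Ek kE1; have : (k%:R : R) < (2 ^ k)%:R by rewrite ltr_nat ltn_expl.
by rewrite -(ltr_pM2r E0) ltNge (le_trans Ek kE1).
Qed.
End Freeness.

(** * From a tower to a cycle *)

Section CycleFromTower.
Context (R : realType) (d : measure_display) (X : measurableType d).
Context (mu : probability X R).
Implicit Types (T U V S : automorphism mu) (A B E : set X) (x y : X).

(** Along a [T]-orbit, iterating the induced transformation enumerates the
    visits to [A] in order, without skipping any. *)
Lemma iter_induced_visits T S A b i : A b ->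
  (forall j, A (iter j S b) -> induced_at T A (iter j S b) (iter j.+1 S b)) ->
  exists k, [/\ iter i S b = iter k T b, A (iter i S b), (0 < k)%N = (0 < i)%N &
    forall l, (0 < l < k)%N -> A (iter l T b) ->
      exists2 i', (0 < i' < i)%N & iter l T b = iter i' S b].
Proof.
move=> Ab ind; elim: i => [|i [k [ek Ai k0 vis]]].
  by exists 0%N; split => // l; rewrite ltn0 andbF.
have [/(_ Ai)[m [m0 Am nm] em] _] := ind i Ai.
have eS : iter i.+1 S b = iter (m + k) T b by rewrite em ek iterD.
exists (m + k)%N; split => //.
- by rewrite em.
- by rewrite addn_gt0 m0.
- move=> l /andP[l0 lmk] Al; case: (ltngtP l k) => lk.
  + have [|i' i'i ei'] := vis l _ Al; first by rewrite l0.
    by exists i' => //; lia.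
  + exfalso; apply: (nm (l - k)%N); first by lia.
    by rewrite ek -iterD subnK // ltnW.
  + exists i; first by rewrite -k0 -lk l0 /=.
    by rewrite lk ek.
Qed.

Section Orbitwise.
Context (T SA SB : automorphism mu) (A B X0 : set X) (n : nat).
Hypotheses (n2 : (2 <= n)%N) (BA : B `<=` A).
Hypothesis invX0 : forall k x, X0 x -> X0 (aut_pow T k x).
Hypothesis indA : forall x, X0 x -> induced_at T A x (SA x).
Hypothesis indB : forall x, X0 x -> induced_at T B x (SB x).
Hypothesis cover : forall x, X0 x -> A x ->
  exists i b, [/\ (i < n)%N, X0 b, B b & x = iter i SA b].
Hypothesis disj : forall i j b b', (i < n)%N -> (j < n)%N ->
  X0 b -> X0 b' -> B b -> B b' -> iter i SA b = iter j SA b' -> i = j.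

Let U := aut_comp (aut_sym SB) SA.

Let X0_SA i b : X0 b -> X0 (iter i SA b).
Proof.
move=> X0b; elim: i => //= i IH.
by have [k _ <-] := induced_at_orbit (indA IH); exact: invX0.
Qed.

Let A_SA i b : X0 b -> B b -> A (iter i SA b).
Proof.
move=> X0b /BA Ab; elim: i => //= i IH.
exact: induced_at_in IH (indA (X0_SA i X0b)).
Qed.

(** If the [n]-th visit to [A] after a point of the base were at a level
   [i > 0], going one step back would put one point on the two levels [n - 1]
   and [i - 1]. *)
Let B_top b : X0 b -> B b -> B (iter n SA b).
Proof.
move=> X0b Bb.
have [i [b' [ilt X0b' Bb' eb]]] := cover (X0_SA n X0b) (A_SA n X0b Bb).
case: i => [|i] in ilt eb *; first by rewrite eb.
have eb' : iter n.-1 SA b = iter i SA b'.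
  by apply: (can_inj (aut_funK SA)); rewrite -!iterS prednK // ltnW.
by have := disj _ _ X0b X0b' Bb Bb' eb'; lia.
Qed.

Let nB_mid i b : X0 b -> B b -> (0 < i < n)%N -> ~ B (iter i SA b).
Proof.
move=> X0b Bb /andP[i0 ilt] Bi.
by have := disj ilt _ X0b (X0_SA i X0b) Bb Bi (j := 0) erefl; lia.
Qed.

(** The visits to [A] before the [n]-th one are on the levels 1 to [n - 1],
    which avoid [B]. *)
Let SB_base b : X0 b -> B b -> SB b = iter n SA b.
Proof.
move=> X0b Bb.
have [k [ek _ k0 vis]] := iter_induced_visits (T := T) n (BA Bb)
  (fun j _ => indA (X0_SA j X0b)).
apply: (induced_at_unique (indB X0b)); split => // _.
exists k => //; split; first by rewrite k0; lia.
  by rewrite -ek; exact: B_top.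
move=> l lk Bl; have [i' i'n ei'] := vis l lk (BA Bl).
by apply: (nB_mid X0b Bb i'n); rewrite -ei'.
Qed.

Let U_iter i b : X0 b -> B b -> (i < n)%N -> iter i U b = iter i SA b.
Proof.
move=> X0b Bb; elim: i => // i IH ilt.
rewrite [LHS]iterS IH ?(ltnW ilt) // /U /=.
apply: (can_inj (aut_funK SB)); rewrite aut_invK.
have [_ ->] := indB (X0_SA i.+1 X0b); first by [].
by apply: nB_mid; rewrite ?ilt.
Qed.

Let U_period b : X0 b -> B b -> iter n U b = b.
Proof.
move=> X0b Bb; rewrite -(prednK (ltnW n2)) iterS U_iter //; last by lia.
by rewrite /U /= -iterS prednK ?(ltnW n2) // -SB_base // aut_funK.
Qed.

Lemma tower_cycle_off x : X0 x -> ~ A x -> U x = x.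
Proof.
move=> X0x nAx; rewrite /U /=; have [_ ->] := indA X0x; last by [].
apply: (can_inj (aut_funK SB)); rewrite aut_invK.
by have [_ ->] := indB X0x; last by move=> /BA.
Qed.

(** Below the top of the tower, [SA] lands outside [B], where [SB] is the
    identity, so [U] climbs one level; from the top, [SA] lands in [B] and
    undoing the first return to [B] leads back to the base point. *)
Lemma tower_cycle_on x : X0 x -> A x ->
  iter n U x = x /\ forall i, (0 < i < n)%N -> iter i U x <> x.
Proof.
move=> X0x Ax; have [i [b [ilt X0b Bb ->]]] := cover X0x Ax.
rewrite -U_iter //; split; first by rewrite -iterD addnC iterD U_period.
move=> j /andP[j0 jn]; rewrite -iterD addnC iterD =>
  /(can_inj (@aut_iterK _ _ _ _ U i)).
rewrite U_iter // => ej.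
by have := disj (j := 0) jn _ X0b X0b Bb Bb ej; lia.
Qed.

End Orbitwise.

Lemma iter_induced_aut_orbit T A i x :
  exists m, iter i (induced_aut T A) x = iter m T x.
Proof.
elim: i => [|i [m e]]; first by exists 0%N.
rewrite iterS e /induced_aut; case: ifP => _; last by exists m.
by exists (return_time T A (iter m T x) + m)%N; rewrite iterD.
Qed.

(** The cycle is [SB^-1 SA], where [SA] and [SB] are the transformations induced
    on [A] and on the base [B]. As both are in the L1 full group, so is it. *)
Lemma L1_cycle_of_tower T A B (n : nat) : measurable A -> (2 <= n)%N ->
  measurable B -> B `<=` A ->
  disjoint_union_mod_null mu A n (fun i => iter i (induced_aut T A) @` B) ->
  exists U : automorphism mu,
    [/\ L1_full_group T U, is_cycle n U & eq_mod_null mu A (aut_support U)].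
Proof.
move=> mA n2 mB BA [cov dis].
have [A0|A0] := pselect (mu A = 0%E).
  exists (aut_id mu); split; first exact: L1_full_group_id.
    apply: aeW => x; left; apply: card_orbit_period => // i; lia.
  exists A; split => // x /= h; apply: contrapT => nA; apply: h.
  by split => // /(_ erefl).
have [SA [LA indA]] := induced_automorphism T mA.
have [SB [LB indB]] := induced_automorphism T mB.
pose F i := iter i (induced_aut T A) @` B.
have dis' : {ae mu, forall x, forall i j, (i < n)%N -> (j < n)%N -> F i x ->
    F j x -> i = j}.
  apply/ae_foralln => i; apply/ae_foralln => j.
  have [/andP[ilt jlt]|nlt] := boolP ((i < n) && (j < n))%N; last first.
    by apply: aeW => x ilt jlt; move: nlt; rewrite ilt jlt.
  have [->|/eqP ij] := eqVneq i j; first exact: aeW.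
  apply: negligibleS (dis i j ilt jlt ij) => x /= h.
  by apply: contrapT => nF; apply: h => _ _ Fi Fj; exfalso; apply: nF.
rewrite /eq_mod_null in cov.
have [X0 [mX0 aeX0 inv good]] := ae_invariant_core T
  (filterI (filterI indA indB) (filterI cov dis')).
have indA0 x : X0 x -> induced_at T A x (SA x) by move=> /good [[]].
have indB0 x : X0 x -> induced_at T B x (SB x) by move=> /good [[]].
have X0ind i b : X0 b -> iter i (induced_aut T A) b = iter i SA b.
  move=> X0b; suff [] : iter i (induced_aut T A) b = iter i SA b /\
    X0 (iter i SA b) by [].
  elim: i => // i [IH X0i]; split.
    by rewrite iterS IH (induced_aut_at A0 (indA0 _ X0i)).
  by rewrite iterS; have [k _ <-] := induced_at_orbit (indA0 _ X0i); exact: inv.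
have X0pre i b : X0 (iter i (induced_aut T A) b) -> X0 b.
  have [m ->] := iter_induced_aut_orbit T A i b.
  by rewrite -aut_pow_nat => /(inv (- m%:Z)); rewrite aut_powN.
have cover x : X0 x -> A x ->
    exists i b, [/\ (i < n)%N, X0 b, B b & x = iter i SA b].
  move=> X0x Ax; have [_ [[/(_ Ax) [i /= ilt [b Bb eb]] _] _]] := good x X0x.
  have X0b : X0 b by apply: (X0pre i); rewrite eb.
  by exists i, b; split => //; rewrite -X0ind.
have disj i j b b' : (i < n)%N -> (j < n)%N ->
    X0 b -> X0 b' -> B b -> B b' -> iter i SA b = iter j SA b' -> i = j.
  move=> ilt jlt X0b X0b' Bb Bb' e.
  have X0x : X0 (iter i (induced_aut T A) b).
    have [m ->] := iter_induced_aut_orbit T A i b.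
    exact: (inv m).
  have [_ [_]] := good _ X0x; apply => //; first by exists b.
  by exists b' => //; rewrite !X0ind.
have off := tower_cycle_off BA indA0 indB0.
have on := tower_cycle_on n2 BA inv indA0 indB0 cover disj.
exists (aut_comp (aut_sym SB) SA); split.
- exact: L1_full_group_comp (L1_full_group_sym LB) LA.
- apply: filterS aeX0 => x X0x; have [Ax|nAx] := pselect (A x).
    by right; have [e ne] := on x X0x Ax; apply: card_orbit_period => //; lia.
  by left; apply: card_orbit_period => [//||i]; [exact: off|lia].
- apply: filterS aeX0 => x X0x; split => [Ax|].
    by have [_ ne] := on x X0x Ax; apply: (ne 1%N).
  by apply: contra_notP => nAx; exact: off.
Qed.

End CycleFromTower.

(** * From a cycle to a tower *)

Section TowerFromCycle.
Context (R : realType) (d : measure_display) (X : measurableType d).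
Context (mu : probability X R).
Implicit Types (T U V S : automorphism mu) (A B E : set X) (x y : X).

Lemma iter_period_mod U (n i : nat) x : (0 < n)%N -> iter n U x = x ->
  iter i U x = iter (i %% n) U x.
Proof.
move=> n0 xn; rewrite -[LHS]aut_pow_nat (aut_pow_mod _ n0 xn).
by rewrite modz_nat.
Qed.

Lemma L1_iter_cocycle T U i : L1_full_group T U ->
  exists c, is_cocycle T (aut_iter U i) c /\ int_integrable mu c.
Proof.
move=> LU; suff : L1_full_group T (aut_iter U i) by move=> [_ [c cU ic]]; exists c.
elim: i => [|i IH]; first exact: L1_full_group_id.
exact: L1_full_group_comp.
Qed.

(** In the application, [D] consists of the last points of the cycles of [U]
    and [h i y] is the distance by which [U^i y] precedes [y] on the orbit. *)
Section Counting.
Context (T : X -> X) (D : set X) (n : nat) (h : 'I_n -> X -> nat).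

(** For [K] large, this counts the points of [A] strictly before [x] on the
    orbit whose cycle is not over before [x]; the last point of that cycle is
    then [T^k x]. *)
Definition overhang K x : nat :=
  \sum_(k < K) \sum_(i < n) (`[< D (iter k T x) >] && (k < h i (iter k T x)))%N.

(** The number of ways in which [x] itself is a point [U^i y] of the cycle of
    some last point [y = T^k x]. *)
Definition landing K x : nat :=
  \sum_(k < K) \sum_(i < n) (`[< D (iter k T x) >] && (h i (iter k T x) == k))%N.

(** Moving from [x] to [T x], the point [x] itself comes to lie behind, which
    adds [landing]; if the cycle of [x] ends at [x], its [n] points stop being
    counted. *)
Lemma overhang_step K x :
  (overhang K (T x) + n * `[< D x >] = overhang K.+1 x + landing K.+1 x)%N.
Proof.
rewrite /overhang /landing -big_split /= big_ord_recl /= addnC.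
congr (_ + _)%N.
  rewrite -big_split /= (eq_bigr (fun=> (`[< D x >] : nat))).
    by rewrite sum_nat_const card_ord.
  by move=> i _; case: `[< _ >] => //=; case: (h i x).
apply: eq_bigr => k _; rewrite -big_split /=; apply: eq_bigr => i _.
rewrite -iterSr /= /bump leq0n add1n /=.
case: `[< _ >] => //=; set v := h i _.
rewrite [(k < v)%N]leq_eqVlt (eq_sym v); case: ltngtP => //.
Qed.

(** The terms of rank [k] vanish as soon as all displacements [h i (T^k x)] are
    at most [k]. *)
Lemma overhang_stable x :
  (forall i, exists K, forall k, (K <= k)%N -> (h i (iter k T x) <= k)%N) ->
  exists K v, forall k, (K <= k)%N -> overhang k x = v.
Proof.
move=> /choice[Kf hK]; pose K := \max_i Kf i.
exists K, (overhang K x) => k; elim: k => [|k IH].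
  by rewrite leqn0 => /eqP ->.
rewrite leq_eqVlt => /orP[/eqP -> //|]; rewrite ltnS => Kk.
rewrite /overhang big_ord_recr /= -/(overhang k x) IH // big1 ?addn0 // => i _.
rewrite ltnNge hK ?andbF //; apply: leq_trans Kk.
exact: leq_bigmax.
Qed.

(** The residue modulo [n] of the limit of [overhang k x], stated so that its
    measurability is that of countable unions and intersections. *)
Definition residue x j :=
  exists K, forall k, (K <= k)%N -> overhang k x = j %[mod n].

Lemma residue_unique x i j : residue x i -> residue x j -> i = j %[mod n].
Proof.
move=> [K1 h1] [K2 h2]; rewrite -(h1 (maxn K1 K2)) ?leq_maxl //.
by rewrite h2 // leq_maxr.
Qed.

Lemma eq_residue x i j : i = j %[mod n] -> residue x i -> residue x j.
Proof. by move=> ij [K hK]; exists K => k /hK ->. Qed.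

Lemma residue_step x (a : bool) j :
  (exists K, forall k, (K <= k)%N -> landing k x = a) ->
  residue x j -> residue (T x) (j + a).
Proof.
move=> [K1 h1] [K2 h2]; exists (maxn K1 K2) => k; rewrite geq_max => /andP[k1 k2].
have := overhang_step k x; rewrite (h1 k.+1) ?(leqW k1) // => e.
by rewrite -(modnMDl `[< D x >]) addnC mulnC e -modnDml h2 ?(leqW k2) // modnDml.
Qed.

End Counting.

Section Orbitwise.
Context (T U : automorphism mu) (A X0 : set X) (n : nat) (c : nat -> X -> int).
Hypothesis n0 : (0 < n)%N.
Hypothesis invX0 : forall k x, X0 x -> X0 (aut_pow T k x).
Hypothesis free : forall x k, X0 x -> (0 < k)%N -> iter k T x <> x.
Hypothesis cU : forall x i, X0 x -> iter i U x = aut_pow T (c i x) x.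
Hypothesis suppU : forall x, X0 x -> A x <-> U x <> x.
Hypothesis cycU : forall x, X0 x -> A x ->
  iter n U x = x /\ forall i, (0 < i < n)%N -> iter i U x <> x.

(** The last point of each cycle of [U] for the order of the [T]-orbit. *)
Definition last_points : set X :=
  [set x | A x /\ forall i, (i < n)%N -> c i x <= 0].

Let D := last_points.
Let h (i : 'I_n) x := `|c i x|%N.

Let pow_inj x k l : X0 x -> aut_pow T k x = aut_pow T l x -> k = l.
Proof.
move=> X0x.
wlog : k l / k <= l => [hw e|kl e].
  by case: (leP k l) => [|/ltW] kl; [|symmetry]; apply: hw.
apply/eqP; rewrite eq_le kl leNgt /=; apply/negP => kl'.
apply: (free (k := `|l - k|%N) X0x); first by lia.
rewrite -aut_pow_nat gez0_abs ?subr_ge0 //.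
by rewrite addrC aut_powD -e aut_powN.
Qed.

Let X0_U i x : X0 x -> X0 (iter i U x).
Proof. by move=> X0x; rewrite cU //; exact: invX0. Qed.

Let A_U i x : X0 x -> A x -> A (iter i U x).
Proof.
move=> X0x Ax; elim: i => //= i /(suppU (X0_U i X0x)) Ai.
by apply/(suppU (X0_U i.+1 X0x)) => /(can_inj (aut_funK U)).
Qed.

(** The displacements from [y := U^m x] are those from [x] diminished by
    [c m x], so the [m] that maximizes [c m x] makes all of them
    nonpositive. *)
Lemma cycle_has_last x : X0 x -> A x -> exists2 m, (m < n)%N & D (iter m U x).
Proof.
move=> X0x Ax; have [xn _] := cycU X0x Ax.
case: (@arg_maxP _ _ 'I_n (Ordinal n0) xpredT (fun i => c i x)) => // m _ hm.
exists m => //; split; first exact: A_U.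
move=> j jn.
have e : aut_pow T (c j (iter m U x) + c m x) x =
    aut_pow T (c ((j + m) %% n)%N x) x.
  rewrite aut_powD -(cU m X0x) -!cU //; last exact: X0_U.
  by rewrite -iterD (iter_period_mod _ n0 xn).
have {}e := pow_inj X0x e.
have := hm (Ordinal (ltn_pmod (j + m) n0)) isT; rewrite /= -e.
by rewrite gerDr.
Qed.

(** The displacements between two last points of one cycle are nonpositive and
    opposite. *)
Lemma cycle_last_unique y m : X0 y -> D y -> D (iter m U y) -> iter m U y = y.
Proof.
move=> X0y Dy; have [yn _] := cycU X0y Dy.1.
rewrite (iter_period_mod m n0 yn); set m' := (m %% n)%N => Dm.
have [m0|m0] := posnP m'; first by rewrite m0.
have m'n : (m' < n)%N by rewrite ltn_mod.
have X0m := X0_U m' X0y.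
have back : aut_pow T (c (n - m')%N (iter m' U y) + c m' y) y = aut_pow T 0 y.
  rewrite aut_powD -(cU m' X0y) -cU //.
  by rewrite -iterD subnK // ltnW.
have c0 := pow_inj X0y back.
have c1 := Dy.2 m' m'n.
have c2 : c (n - m')%N (iter m' U y) <= 0 by apply: Dm.2; lia.
have cm0 : c m' y = 0 by lia.
by rewrite (cU m' X0y) cm0.
Qed.

Let landingE x k (i : 'I_n) : X0 x -> D (iter k T x) -> h i (iter k T x) = k ->
  iter i U (iter k T x) = x.
Proof.
move=> X0x [_ Dx] hk; have := Dx i (ltn_ord i); rewrite /h in hk => c0.
rewrite cU; last by rewrite -aut_pow_nat; exact: invX0.
rewrite -[in RHS](aut_powN T k x); congr (aut_pow T _ _).
by lia.
Qed.

(** Each point of [A] lies in the cycle of exactly one last point, at exactly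
    one position, and that last point is not behind it on the orbit. *)
Lemma landing_eventually x : X0 x ->
  exists K, forall k, (K <= k)%N -> landing T D h k x = `[< A x >].
Proof.
move=> X0x; case: asboolP => Ax; last first.
  exists 0%N => K _; rewrite /landing big1 // => k _; rewrite big1 // => i _.
  case: asboolP => //= Dk; case: eqP => //= hk; exfalso; apply: Ax.
  rewrite -(landingE X0x Dk hk); apply: A_U Dk.1.
  by rewrite -aut_pow_nat; exact: invX0.
have [xn np] := cycU X0x Ax.
have [m mn Dm] := cycle_has_last X0x Ax.
set y := iter m U x in Dm.
have X0y : X0 y by exact: X0_U.
have in_lt : ((n - m) %% n < n)%N by rewrite ltn_mod.
pose i0 := Ordinal in_lt.
have [yn npy] := cycU X0y Dm.1.
have yx : iter i0 U y = x.
  by rewrite /= -iter_period_mod // /y -iterD subnK // ltnW.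
pose k0 := h i0 y.
have yk : y = iter k0 T x.
  rewrite -[in RHS]yx cU // -aut_pow_nat -aut_powD.
  have := Dm.2 i0 in_lt; rewrite /k0 /h => c0.
  by rewrite (_ : _ + _ = 0) //; lia.
have sole k (i : 'I_n) : D (iter k T x) -> h i (iter k T x) = k ->
    k = k0 /\ i = i0.
  move=> Dk hk; have X0k : X0 (iter k T x) by rewrite -aut_pow_nat; exact: invX0.
  have ex := landingE X0x Dk hk.
  have ky : iter k T x = y.
    have := cycle_last_unique (m := m + i) X0k Dk.
    by rewrite iterD ex -/y => /(_ Dm).
  have kk0 : k = k0.
    by have := @pow_inj x k k0 X0x; rewrite !aut_pow_nat ky yk => /(_ erefl) [].
  split => //; apply/ord_inj/eqP; rewrite ky -[in RHS]yx in ex.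
  have : iter (maxn i i0 - minn i i0) U y = y.
    case: (leqP i i0) => ii0; apply: iter_sub_period => //; exact: ltnW.
  have := ltn_ord i; have := ltn_ord i0 => i0n iN.
  rewrite eqn_leq; case: (posnP (maxn i i0 - minn i i0)) => [|mm /npy].
    by lia.
  by case; lia.
exists k0.+1 => K kK; rewrite /landing (bigD1 (Ordinal kK)) //= (bigD1 i0) //=.
rewrite -yk asboolT // eqxx /= big1 ?addn0; last first.
  move=> i /eqP ii0; case: eqP => //= hi; exfalso; apply: ii0.
  by have [] := @sole k0 i; rewrite -?yk.
rewrite big1 ?addn0 // => k /eqP kk0; rewrite big1 // => i _.
case: asboolP => //= Dk; case: eqP => //= hk; exfalso; apply: kk0.
by apply: val_inj; have [] := sole k i Dk hk.
Qed.

(** The residue grows by one at each visit to [A] and is constant between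
    visits. *)
Lemma residue_visit x y j : X0 x -> A x -> induced_at T A x y ->
  residue T D h x j -> residue T D h y j.+1.
Proof.
move=> X0x Ax [/(_ Ax)[k [k0 _ nA] ->] _] rx.
rewrite -(prednK k0) in nA *; elim: k.-1 nA => [|l IH] nA.
  by have := residue_step (landing_eventually X0x) rx; rewrite asboolT // addn1.
have rl : residue T D h (iter l.+1 T x) j.+1.
  by apply: IH => i il; apply: nA; lia.
have := residue_step (landing_eventually (invX0 l.+1 X0x)) rl.
by rewrite asboolF ?addn0 // => /=; apply: (nA l.+1); rewrite ltnS leqnn.
Qed.

End Orbitwise.

Lemma levels_iter T (I : Type) (f : X -> I) k :
  measurable_levels f -> measurable_levels (fun x => f (iter k T x)).
Proof. by move=> mf P; exact: (measurable_iter_preimage T k (mf P)). Qed.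

Lemma measurable_residue T (D : set X) (n : nat) (h : 'I_n -> X -> nat) j :
  measurable D -> (forall i, measurable_levels (h i)) ->
  measurable [set x | residue T D h x j].
Proof.
move=> mD mh.
have mo K : measurable_levels (overhang T D h K).
  apply: levels_sum => k; apply: levels_sum => i.
  apply: (@levels_iter T _ (fun x => `[< D x >] && (k < h i x)%N : nat)).
  apply: (levels_op (fun (b : bool) m => (b && (k < m)%N) : nat)) => //.
  exact: levels_asbool.
rewrite (_ : [set _ | _] = \bigcup_K \bigcap_(k in [set k | (K <= k)%N])
  (overhang T D h k @^-1` [set v | v = j %[mod n]])).
  apply: bigcupT_measurable => K; apply: bigcap_measurableType => k _.
  exact: mo.
by apply/seteqP; split => x /= [K]; [move=> hK; exists K|move=> _ hK; exists K].
Qed.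

Lemma measurable_last_points A (n : nat) (c : nat -> X -> int) :
  measurable A -> (forall i, measurable_levels (c i)) ->
  measurable (last_points A n c).
Proof.
move=> mA mc; rewrite (_ : last_points A n c =
  A `&` \bigcap_(i in `I_n) (c i @^-1` [set z | z <= 0])) //.
apply: measurableI => //; apply: bigcap_measurableType => i _.
exact: mc.
Qed.

(** The level [i] of the tower is the part of [A] where the residue is [i]: the
    induced transformation adds one to the residue, and being invertible it
    reaches each point of level [i] from level 0 in [i] steps. *)
Lemma tower_of_L1_cycle T A (n : nat) : measurable A -> (2 <= n)%N ->
  {ae mu, forall x, forall k, (0 < k)%N -> iter k T x <> x} ->
  (exists U : automorphism mu,
    [/\ L1_full_group T U, is_cycle n U & eq_mod_null mu A (aut_support U)]) ->
  exists B, [/\ measurable B, B `<=` A &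
    disjoint_union_mod_null mu A n (fun i => iter i (induced_aut T A) @` B)].
Proof.
move=> mA n2 freeT [U [LU cycU suppU]].
have [A0|A0] := pselect (mu A = 0%E).
  exists set0; split => //; split; last first.
    by move=> i j _ _ _; rewrite image_set0 set0I; exact: negligible_set0.
  exists A; split => // x /= h; apply: contrapT => nA; apply: h.
  by split => // -[i _ [b]].
have n0 : (0 < n)%N by exact: ltnW.
have [c cc] := choice (fun i => L1_iter_cocycle i LU).
have cU := ae_foralln (fun i => (cc i).1).
have small := ae_foralln (fun i => ae_cocycle_le_time T (cc i).2).
have [S [LS indS]] := induced_automorphism T mA.
rewrite /eq_mod_null in suppU.
have [X0 [mX0 aeX0 inv good]] := ae_invariant_core T
  (filterI (filterI freeT (filterI cU small))
    (filterI (filterI cycU suppU) (filterI indS (L1_full_group_sym LS).1))).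
have free x k : X0 x -> (0 < k)%N -> iter k T x <> x.
  by move=> /good [[/(_ k)]].
have cU0 x i : X0 x -> iter i U x = aut_pow T (c i x) x.
  by move=> /good [[_ [/(_ i) <- _]] _]; rewrite aut_iterE.
have small0 x i : X0 x -> exists K, forall k, (K <= k)%N ->
    (`|c i (iter k T x)| <= k)%N.
  by move=> /good [[_ [_ sm]] _]; exact: sm.
have supp0 x : X0 x -> A x <-> U x <> x by move=> /good [_ [[]]].
have ind0 x : X0 x -> induced_at T A x (S x) by move=> /good [_ [_ []]].
have inv0 x : X0 x -> X0 (aut_inv S x).
  by move=> X0x; have [_ [_ [_ [k _ /= <-]]]] := good x X0x; exact: inv.
have cyc0 x : X0 x -> A x ->
    iter n U x = x /\ forall i, (0 < i < n)%N -> iter i U x <> x.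
  move=> X0x Ax; have [_ [[+ _] _]] := good x X0x.
  move=> [] /period_card_orbit[_ xn np] //.
  by have /(supp0 x X0x) := Ax.
pose D := last_points A n c; pose h (i : 'I_n) x := `|c i x|%N.
pose r x j := residue T D h x j.
have r_ex x : X0 x -> exists2 j, (j < n)%N & r x j.
  move=> X0x; have [K [v hv]] := overhang_stable (T := T) D (h := h)
    (fun i : 'I_n => small0 x i X0x).
  exists (v %% n)%N; first by rewrite ltn_mod.
  by exists K => k /hv ->; rewrite modn_mod.
have r_uniq x i j : (i < n)%N -> (j < n)%N -> r x i -> r x j -> i = j.
  move=> ilt jlt ri rj; have := residue_unique ri rj.
  by rewrite !modn_small.
have r_S x j : X0 x -> A x -> r x j -> r (S x) j.+1.
  move=> X0x Ax.
  exact: (residue_visit n0 inv free cU0 supp0 cyc0 X0x Ax (ind0 x X0x)).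
have X0_S i x : X0 x -> X0 (iter i S x).
  move=> X0x; elim: i => //= i IH.
  by have [k _ <-] := induced_at_orbit (ind0 _ IH); exact: inv.
have A_S i x : X0 x -> A x -> A (iter i S x).
  move=> X0x Ax; elim: i => //= i IH.
  exact: induced_at_in IH (ind0 _ (X0_S i x X0x)).
have r_iter i x j : X0 x -> A x -> r x j -> r (iter i S x) (i + j)%N.
  move=> X0x Ax rx; elim: i => //= i IH.
  by apply: r_S => //; [exact: X0_S|exact: A_S].
have ind_iter i x : X0 x -> iter i (induced_aut T A) x = iter i S x.
  move=> X0x; elim: i => //= i ->.
  exact: induced_aut_at A0 (ind0 _ (X0_S i x X0x)).
have descend j x : (j < n)%N -> X0 x -> A x -> r x j ->
    exists b, [/\ X0 b, A b, r b 0%N & x = iter j S b].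
  elim: j x => [|j IH] x jn X0x Ax rx; first by exists x.
  pose w := aut_inv S x.
  have Sw : S w = x by rewrite /w aut_invK.
  have X0w : X0 w by exact: inv0.
  have Aw : A w.
    apply: contrapT => nAw; have [_ /(_ nAw) e] := ind0 w X0w.
    by apply: nAw; rewrite -e Sw.
  have [i ilt rw] := r_ex w X0w.
  have rj : r w j.
    have := residue_unique (r_S w i X0w Aw rw); rewrite Sw => /(_ _ rx) e.
    apply: eq_residue rw; apply/eqP.
    by rewrite -(eqn_modDr 1) !addn1; apply/eqP.
  have [b [X0b Ab rb e]] := IH w (ltnW jn) X0w Aw rj.
  by exists b; split => //; rewrite -Sw e.
exists (A `&` X0 `&` [set x | r x 0%N]); split.
- apply: measurableI; first exact: measurableI.
  have mc i : measurable_levels (c i) := int_integrable_levels (cc i).2.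
  apply: measurable_residue; first exact: measurable_last_points.
  by move=> i; exact: (levels_comp absz).
- by move=> x [[]].
split.
  apply: filterS aeX0 => x X0x; split => [Ax|[i /= ilt [b [[Ab X0b] _] <-]]].
    have [j jn rx] := r_ex x X0x.
    have [b [X0b Ab rb ->]] := descend j x jn X0x Ax rx.
    by exists j => //; exists b => //; rewrite ind_iter.
  by rewrite ind_iter //; exact: A_S.
move=> i j ilt jlt ij; rewrite (_ : _ `&` _ = set0); first exact: negligible_set0.
apply/seteqP; split => // x [[b [[Ab X0b] rb] <-] [b' [[Ab' X0b'] rb']]].
rewrite !ind_iter // => e; apply: ij.
apply: (r_uniq (iter i S b)) => //.
  by have := r_iter i b 0%N X0b Ab rb; rewrite addn0.
by have := r_iter j b' 0%N X0b' Ab' rb'; rewrite addn0 e.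
Qed.

End TowerFromCycle.

Theorem theorem4p8 (R : realType) (d : measure_display) (X : measurableType d)
    (mu : probability X R) (hX : standard_borel R X) (hmu : nonatomic mu)
    (T : automorphism mu) (hT : ergodic T)
    (A : set X) (mA : measurable A) (n : nat) (hn : (2 <= n)%N) :
  (exists U : automorphism mu,
     [/\ L1_full_group T U, is_cycle n U & eq_mod_null mu A (aut_support U)])
  <->
  (exists B : set X,
     [/\ measurable B, B `<=` A &
         disjoint_union_mod_null mu A n
           (fun i => iter i (induced_aut T A) @` B)]).
Proof.
split; first exact: tower_of_L1_cycle mA hn (ergodic_aperiodic hX hmu hT).
by move=> [B [mB BA tower]]; exact: L1_cycle_of_tower tower.
Qed.
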